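(* Fix positive integers $c$ and $N$. For $n\ge N+1$ let $p_{cn,N}(n)$ be the probability that a (uniformly random) $cn$-tuple of functions between $cn$ sets of cardinality $n$ is eventually $N$-cyclic. Then $$\lim_{n\to\infty}p_{cn,N}(n)=\frac1N\,e^{-c\binom N2}\left(1-e^{-cN}\right).$$
   Context: For a positive integer $k$ (here $k=cn$), a $k$-tuple of functions between $k$ pairwise disjoint sets $X_1,\dots,X_k$ of cardinality $n$ means $(f_1,\dots,f_k)$ with $f_i:X_i\to X_{i+1}$, indices modulo $k$ ($X_{k+1}=X_1$). There are $n^{kn}$ such tuples and $p_{k,N}(n)$ is the proportion that are eventually $N$-cyclic. The tuple is eventually $N$-cyclic if the iterated images $(f_k\cdots f_1)^m(X_1)$ eventually stabilize (for large $m$) to a subset of $X_1$ of cardinality $N$ on which $f_k\cdots f_1$ acts as an $N$-cycle (a single cyclic permutation of all $N$ elements). *)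

(* Defs.v *)
From HB Require Import structures.
From mathcomp Require Import all_boot all_order all_algebra.
From mathcomp Require Import all_classical all_reals all_analysis.

Set Implicit Arguments.
Unset Strict Implicit.
Unset Printing Implicit Defensive.

Import Order.TTheory GRing.Theory Num.Theory.
Import numFieldNormedType.Exports.

(* The k disjoint n-element sets X_1, ..., X_k are k labelled copies of 'I_n:
   the component [f i] of a tuple (i counted from 0) goes from the copy with
   label i to the next one, and the last component returns to the first copy. *)
Definition fun_tuple (k n : nat) : finType :=
  {ffun 'I_k -> {ffun 'I_n -> 'I_n}}.

(* f_k \o ... \o f_1: [enum 'I_k] is increasing, so f_1 is applied first. *)
Definition composite (k n : nat) (f : fun_tuple k n) (x : 'I_n) : 'I_n :=
  foldl (fun (y : 'I_n) (i : 'I_k) => f i y) x (enum 'I_k).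

(* [ufcycle g s] says that the entries of s are pairwise distinct and that g
   maps each of them to the next one, and the last one to the first one. *)
Definition acts_as_cycle (T : finType) (g : T -> T) (Y : {set T}) : Prop :=
  exists s : seq T, ufcycle g s /\ Y = [set x in s]%SET.

Definition eventually_cyclic (k n N : nat) (f : fun_tuple k n) : Prop :=
  exists Y : {set 'I_n},
    [/\ exists M : nat, forall m : nat, (M <= m)%N ->
          [set iter m (composite f) x | x in [set: 'I_n]]%SET = Y,
        #|Y| = N
      & acts_as_cycle (composite f) Y].

Definition proba_eventually_cyclic (R : realType) (k N n : nat) : R :=
  (#|[set f : fun_tuple k n | `[< eventually_cyclic N f >]]%SET|%:R
     / #|fun_tuple k n|%:R)%R.

(* Main.v *)
Require Import Defs.
From mathcomp Require Import all_boot all_order all_algebra.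
From mathcomp Require Import all_classical all_reals all_analysis.
From mathcomp Require Import fintype finset fingroup perm.

(* Let g = f_k \o ... \o f_1 and let E be its eventual image, on which g is a
   permutation. Composing f_k with a permutation p of E does not change E and
   replaces the restriction of g to E by its composite with p; so, given E, this
   restriction is a uniformly random permutation of E.
   - The expected number of injective N-tuples of fixed points of a uniform
     permutation of an M-element set is 1 if N <= M and 0 otherwise. Hence
     P(#|E| >= N) is the expected number of injective N-tuples of fixed points
     of g, and counting the f_i that carry such a tuple through injective
     N-tuples gives P(#|E| >= N) = (n ^_ N / n ^ N) ^ k.
   - A permutation of N elements is an N-cycle with probability 1/N, so
     p_{k,N}(n) = (P(#|E| >= N) - P(#|E| >= N + 1)) / N.
   With k = c n, each factor (1 - i/n)^(c n) of (n ^_ N / n ^ N) ^ k tends to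
   exp(- c i). *)

Set Implicit Arguments.
Unset Strict Implicit.
Unset Printing Implicit Defensive.

(** * Eventual image of a self-map of a finite set *)

Section StableImage.
Variable T : finType.
Implicit Types (g : T -> T) (p : {perm T}) (Y : {set T}).

Definition stable_image g : {set T} := iter #|T| g @: setT.

Lemma imset_iterS g m Y : iter m.+1 g @: Y = g @: (iter m g @: Y).
Proof. by rewrite -imset_comp. Qed.

Lemma imset_iter_id g m Y : g @: Y = Y -> iter m g @: Y = Y.
Proof.
move=> gY; elim: m => [|m IHm]; first exact: imset_id.
by rewrite imset_iterS IHm.
Qed.

(** The images of the iterates decrease and lose an element at each step until they become
    stationary, so [#|T|] iterations suffice. *)
Lemma imset_stable_image g : g @: stable_image g = stable_image g.
Proof.
have sub m : iter m.+1 g @: setT \subset iter m g @: setT.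
  by apply/subsetP => _ /imsetP[x _ ->]; rewrite iterSr imset_f.
(* Either the chain is stationary at [m], or at least [m] elements are lost; for [m = #|T|] the
   second case leaves the empty set, which is stationary too. *)
suff decr m : g @: (iter m g @: setT) = iter m g @: setT \/
              #|iter m g @: setT| + m <= #|T|.
  have [//|] := decr #|T|; rewrite -[leqRHS]add0n leq_add2r leqn0 cards_eq0.
  by rewrite /stable_image => /eqP ->; rewrite imset0.
elim: m => [|m [IHm|IHm]]; first by right; rewrite addn0 max_card.
  by left; rewrite imset_iterS IHm.
have := sub m; rewrite subEproper => /predU1P[eq_m|/proper_card lt_m].
  by left; rewrite eq_m -imset_iterS.
by right; rewrite addnS -addSn (leq_trans _ IHm) // leq_add2r.
Qed.

(** [iter M g] preserves the stable image and lands in [Y]; [iter #|T| g] preserves [Y] and lands in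
    the stable image. *)
Lemma stable_image_unique g Y M :
  g @: Y = Y -> (forall x, iter M g x \in Y) -> stable_image g = Y.
Proof.
move=> gY gM; apply/eqP; rewrite eqEsubset; apply/andP; split.
  rewrite -(imset_iter_id M (imset_stable_image g)).
  by apply/subsetP => _ /imsetP[x _ ->].
by rewrite -(imset_iter_id #|T| gY) imsetS // subsetT.
Qed.

Lemma iter_stable_image g x : iter #|T| g x \in stable_image g.
Proof. exact: imset_f. Qed.

Lemma stable_image_stab g x : x \in stable_image g -> g x \in stable_image g.
Proof. by move=> xE; rewrite -imset_stable_image imset_f. Qed.

Lemma stable_image_inj g : {in stable_image g &, injective g}.
Proof. by apply/imset_injP; rewrite imset_stable_image. Qed.

Lemma stable_image_fix g x : g x = x -> x \in stable_image g.
Proof. by move=> gx; rewrite -(iter_fix #|T| gx) iter_stable_image. Qed.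

Lemma stable_image_imset_iter g m :
  #|T| <= m -> [set iter m g x | x in [set: T]] = stable_image g.
Proof.
move=> lem; rewrite -(subnK lem) -[RHS](@imset_iter_id g (m - #|T|)).
  by rewrite -imset_comp; apply: eq_imset => x; rewrite iterD.
exact: imset_stable_image.
Qed.

Lemma stable_image_perm g p :
  perm_on (stable_image g) p -> stable_image (p \o g) = stable_image g.
Proof.
move=> pE; apply: (@stable_image_unique _ _ #|T|) => [|x].
  by rewrite imset_comp imset_stable_image im_perm_on.
(* Since [p] fixes every point outside the stable image, an orbit of [p \o g] follows that of [g]
   until it enters this set, and never leaves it afterwards. *)
have: (iter #|T| (p \o g) x \in stable_image g) ||
      (iter #|T| (p \o g) x == iter #|T| g x).
  elim: #|T| => [|m IHm] /=; first by rewrite eqxx orbT.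
  rewrite perm_closed //; case/orP: IHm => [/stable_image_stab -> //|/eqP ->].
  have [//|gxE] /= := boolP (g _ \in _).
  by rewrite (out_perm pE gxE).
by case/orP => // /eqP ->; exact: iter_stable_image.
Qed.

End StableImage.

(** * Permutations of a subset with prescribed values *)

Section PermExtension.
Variable T : finType.
Implicit Types (p : {perm T}) (E : {set T}) (s t : seq T).

Lemma perm_on_tperm E x y : x \in E -> y \in E -> perm_on E (tperm x y).
Proof.
move=> xE yE; apply/subsetP => z; rewrite inE.
by case: tpermP => [->|->|] //; rewrite eqxx.
Qed.

Lemma perm_on_extend E s t :
    size s = size t -> uniq s -> uniq t -> {subset s <= E} -> {subset t <= E} ->
  exists2 p : {perm T}, perm_on E p & map p s = t.
Proof.
elim/last_ind: s t => [|s x IHs] t; first by case: t => // *; exists 1%g; rewrite ?perm_on1.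
elim/last_ind: t => [|t y _]; rewrite !size_rcons // => -[st].
rewrite !rcons_uniq => /andP[xs us] /andP[yt ut] sE tE.
have [z zs|z zt|p pE pst] := IHs _ st us ut.
- by apply: sE; rewrite mem_rcons inE zs orbT.
- by apply: tE; rewrite mem_rcons inE zt orbT.
have xE : x \in E by apply: sE; rewrite mem_rcons mem_head.
have yE : y \in E by apply: tE; rewrite mem_rcons mem_head.
(* The transposition corrects the image of [x] and keeps the values on [s]: neither [p x] nor [y]
   occurs in [t], which is [map p s]. *)
exists (p * tperm (p x) y)%g.
  by rewrite perm_onM // perm_on_tperm ?perm_closed.
rewrite map_rcons permM tpermL; congr (rcons _ _); rewrite -[RHS]pst.
apply/eq_in_map => z zs; rewrite permM tpermD //.
  by rewrite (inj_eq perm_inj); apply: contraNneq xs => ->.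
by apply: contraNneq yt => ->; rewrite -pst map_f.
Qed.

(** One solution [q] exists, and all solutions are the products [r * q] with [r] a permutation of
    [E] minus the entries of [s]. *)
Lemma card_perm_on_map E s t :
    size s = size t -> uniq s -> uniq t -> {subset s <= E} -> {subset t <= E} ->
  #|[set p : {perm T} | perm_on E p & map p s == t]| = (#|E| - size s)`!.
Proof.
move=> st us ut sE tE; have [q qE qst] := perm_on_extend st us ut sE tE.
have -> : #|E| - size s = #|E :\: [set x in s]|.
  rewrite cardsD (setIidPr _) ?cardsE ?(card_uniqP us) //.
  by apply/subsetP => x; rewrite inE => /sE.
rewrite -card_perm -[RHS](card_imset _ (mulIg q)); apply: eq_card => p.
apply/idP/imsetP => [|[r]].
  rewrite inE => /andP[pE /eqP pst]; exists (p * q^-1)%g; last by rewrite mulgKV.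
  rewrite unfold_in; apply/subsetP => x; rewrite !inE permM => pqx; apply/andP; split.
    apply: contraNN pqx => xs.
    by have /eq_in_map/(_ x xs) -> := etrans pst (esym qst); rewrite permK.
  apply: contraNT pqx => xE; rewrite (out_perm pE xE).
  by rewrite (out_perm _ xE) // perm_onV.
rewrite unfold_in => rE ->; rewrite inE perm_onM //=.
  rewrite -[X in _ == X]qst; apply/eqP/eq_in_map => x xs; rewrite permM.
  by rewrite (out_perm rE) // !inE xs.
by apply: (subset_trans rE); rewrite subsetDl.
Qed.

End PermExtension.

(** * Averaging over the permutations of the eventual image *)

Section Averaging.
Variable T : finType.
Implicit Types (g : {ffun T -> T}) (p : {perm T}) (E : {set T}).

Definition post_perm p g : {ffun T -> T} := [ffun x => p (g x)].

Lemma post_permK p : cancel (post_perm p) (post_perm p^-1).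
Proof. by move=> g; apply/ffunP => x; rewrite !ffunE permK. Qed.

Lemma post_permKV p : cancel (post_perm p^-1) (post_perm p).
Proof. by move=> g; apply/ffunP => x; rewrite !ffunE permKV. Qed.

Lemma stable_image_post_perm p g :
  perm_on (stable_image g) p -> stable_image (post_perm p g) = stable_image g.
Proof.
move=> pE; rewrite -(stable_image_perm pE).
have eq_pg : post_perm p g =1 p \o g by move=> x; rewrite ffunE.
by apply: eq_imset => x; apply: eq_iter.
Qed.

Variables (N : nat) (sigma : N.-tuple T -> N.-tuple T).
Hypothesis sigmaP : forall s, perm_eq (sigma s) s.

Lemma sum_perm_on_tuples g (E := stable_image g) :
  \sum_(p | perm_on E p) #|[set s : N.-tuple T |
      [&& uniq s, all [in E] s & map (post_perm p g) s == sigma s]]| =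
  if N <= #|E| then (#|E|)`! else 0.
Proof.
under eq_bigr => p _ do rewrite -sum1dep_card.
transitivity (\sum_(s : N.-tuple T | uniq s && all [in E] s)
    \sum_(p | perm_on E p && (map p (map g s) == sigma s)) 1).
  under [RHS]eq_bigr => s _ do rewrite big_mkcondr.
  rewrite exchange_big /=; apply: eq_bigr => p _.
  rewrite -big_mkcondr; apply: eq_bigl => s; rewrite andbA -map_comp.
  by congr (_ && (_ == _)); apply: eq_map => x; rewrite ffunE.
transitivity (\sum_(s : N.-tuple T | uniq s && all [in E] s) (#|E| - N)`!).
  apply: eq_bigr => s /andP[us sE]; rewrite sum1dep_card card_perm_on_map.
  - by rewrite size_map size_tuple.
  - by rewrite size_map !size_tuple.
  - rewrite map_inj_in_uniq // => x y xs ys; apply: stable_image_inj.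
      exact: (allP sE).
    exact: (allP sE).
  - by rewrite (perm_uniq (sigmaP s)).
  - by move=> _ /mapP[x xs ->]; apply/stable_image_stab/(allP sE).
  - by move=> x; rewrite (perm_mem (sigmaP s)) => /(allP sE).
rewrite sum_nat_const.
have -> : #|[pred s : N.-tuple T | uniq s && all [in E] s]| = #|E| ^_ N.
  by rewrite -card_uniq_tuples cardsE; apply: eq_card => s; rewrite !inE andbC.
case: leqP => [|lt]; first exact: ffact_fact.
by rewrite ffact_small.
Qed.

(** Among the maps with a given stable image [E], replacing [g] by [post_perm p g] is a bijection
    preserving [mu]; averaging over [p] gives one tuple per map if [N <= #|E|], and none
    otherwise. *)
Lemma sum_stable_tuples (mu : {ffun T -> T} -> nat) :
    (forall g p, perm_on (stable_image g) p -> mu (post_perm p g) = mu g) ->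
  \sum_(g : {ffun T -> T}) mu g * #|[set s : N.-tuple T |
      [&& uniq s, all [in stable_image g] s & map g s == sigma s]]| =
  \sum_(g : {ffun T -> T} | N <= #|stable_image g|) mu g.
Proof.
move=> muP.
pose Phi g E := #|[set s : N.-tuple T |
      [&& uniq s, all [in E] s & map g s == sigma s]]|.
rewrite (partition_big (fun g : {ffun T -> T} => stable_image g) predT) //=.
rewrite [RHS](partition_big (fun g : {ffun T -> T} => stable_image g) predT) //=.
apply: eq_bigr => E _; apply/eqP; rewrite -(eqn_pmul2r (fact_gt0 #|E|)); apply/eqP.
transitivity (\sum_(p | perm_on E p) \sum_(g : {ffun T -> T} | stable_image g == E)
    mu g * Phi g E).
  rewrite sum_nat_const card_perm mulnC; congr (_ * _).
  by apply: eq_bigr => g /eqP <-.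
transitivity (\sum_(g : {ffun T -> T} | stable_image g == E)
    mu g * (if N <= #|E| then (#|E|)`! else 0)); last first.
  rewrite -big_distrl /= big_mkcondl /=; case: ifP => NE; last first.
    by rewrite muln0 big1 // => g /eqP ->; rewrite NE.
  by congr (_ * _); apply: eq_bigr => g /eqP ->; rewrite NE.
transitivity (\sum_(p | perm_on E p) \sum_(g : {ffun T -> T} | stable_image g == E)
    mu g * Phi (post_perm p g) E).
  apply: eq_bigr => p pE.
  rewrite (reindex_onto (post_perm p) (post_perm p^-1)) /=; last first.
    by move=> g _; apply: post_permKV.
  have stE g : (stable_image (post_perm p g) == E) = (stable_image g == E).
    apply/eqP/eqP => Eg; last by rewrite stable_image_post_perm ?Eg.
    by rewrite -[g](post_permK p) stable_image_post_perm ?Eg // perm_onV.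
  apply: eq_big => [g|g]; first by rewrite post_permK eqxx andbT stE.
  by rewrite stE => /andP[/eqP Eg _]; rewrite muP ?Eg.
rewrite exchange_big; apply: eq_bigr => g /eqP <-.
by rewrite -big_distrr /= sum_perm_on_tuples.
Qed.

End Averaging.

(** * Counting cycles and fixed points by tuples *)

Section CyclicCount.
Variable T : finType.

Lemma fcycle_map_rot (g : T -> T) (s : seq T) : fcycle g s = (map g s == rot 1 s).
Proof.
case: s => // x s; rewrite rot1_cons /cycle -[in RHS](belast_rcons x s x).
suff fpathE y q : fpath g y q = (map g (belast y q) == q) by exact: fpathE.
by elim: q y => //= z q IHq y; rewrite eqseq_cons IHq.
Qed.

Definition cycle_tuples N (g : T -> T) : {set N.-tuple T} :=
  [set s : N.-tuple T | [&& uniq s, all [in stable_image g] s & map g s == rot 1 s]].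

Definition cyclic_stable_image N (g : T -> T) :=
  (#|stable_image g| == N) && (cycle_tuples N g != set0).

Lemma mem_cycle_tuple N (g : T -> T) s :
  #|stable_image g| = N -> s \in cycle_tuples N g -> s =i stable_image g.
Proof.
move=> EN; rewrite inE => /and3P[us /allP sE _].
have: [set x in s] == stable_image g.
  rewrite eqEcard EN cardsE (card_uniqP us) size_tuple leqnn andbT.
  by apply/subsetP => x; rewrite inE => /sE.
by move=> /eqP <- x; rewrite inE.
Qed.

(** A cycle tuple is the orbit of its head, hence determined by it, and rotating one such tuple
    brings any point of the stable image to the head. *)
Lemma card_cycle_tuples N (g : T -> T) : 0 < N ->
  #|stable_image g| = N -> #|cycle_tuples N g| = N * cyclic_stable_image N g.
Proof.
move=> N0 EN; rewrite /cyclic_stable_image EN eqxx /=.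
have [-> | [s0 s0S]] := set_0Vmem (cycle_tuples N g).
  by rewrite cards0 eqxx muln0.
have -> : cycle_tuples N g != set0 by apply/set0Pn; exists s0.
rewrite muln1 -[RHS]EN.
have [x0 x0E] : exists x, x \in stable_image g.
  by apply/card_gt0P; rewrite EN.
have orbit_head s : s \in cycle_tuples N g -> val s = orbit g (head x0 s).
  rewrite inE -fcycle_map_rot => /and3P[us _].
  case: s us => -[|x s] /= sN us cs; first by rewrite -(eqP sN) in N0.
  by rewrite -(undup_cycle_cons cs) undup_id.
rewrite -(@card_in_imset _ _ (fun s : N.-tuple T => head x0 s)); last first.
  move=> s t sS tS /= hst; apply: val_inj.
  by rewrite [LHS]orbit_head // [RHS]orbit_head // hst.
apply: eq_card => x; apply/imsetP/idP => [[s sS ->]|xE].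
  rewrite -(mem_cycle_tuple EN sS); case: s {sS} => -[|y s] /= sN.
    by rewrite -(eqP sN) in N0.
  exact: mem_head.
exists (rot_tuple (index x s0) s0).
  move: s0S; rewrite !inE -!fcycle_map_rot rot_uniq rot_cycle.
  by rewrite (eq_all_r (mem_rot _ _)).
by rewrite /= rot_index // (mem_cycle_tuple EN s0S).
Qed.

Lemma sum_cyclic_stable_image N (mu : {ffun T -> T} -> nat) : 0 < N ->
    (forall (g : {ffun T -> T}) p, perm_on (stable_image g) p -> mu (post_perm p g) = mu g) ->
  N * \sum_(g : {ffun T -> T} | cyclic_stable_image N g) mu g =
  \sum_(g : {ffun T -> T} | #|stable_image g| == N) mu g.
Proof.
(* Setting the weight to zero unless the stable image has exactly [N] elements leaves only full
   cycles, each counted by its [N] rotations. *)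
move=> N0 muP; pose mu' (g : {ffun T -> T}) := if #|stable_image g| == N then mu g else 0.
have mu'P (g : {ffun T -> T}) p : perm_on (stable_image g) p -> mu' (post_perm p g) = mu' g.
  by move=> pE; rewrite /mu' stable_image_post_perm // muP.
have rotP (s : N.-tuple T) : perm_eq (rot_tuple 1 s) s by rewrite perm_rot.
have := sum_stable_tuples rotP mu'P.
rewrite -[X in _ = X]big_mkcondr.
rewrite [RHS](eq_bigl (fun g : {ffun T -> T} => #|stable_image g| == N)); last first.
  by move=> g /=; case: eqP => [->|_]; rewrite ?leqnn ?andbF.
move <-; rewrite big_mkcond big_distrr; apply: eq_bigr => g _ /=.
rewrite -/(cycle_tuples N g) /mu'.
have [EN|EN] := eqVneq #|stable_image g| N.
  by rewrite card_cycle_tuples //; case: cyclic_stable_image; rewrite ?muln1 ?muln0 // mulnC.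
by rewrite /cyclic_stable_image (negPf EN) muln0.
Qed.

Definition fixed_tuples N (g : T -> T) : {set N.-tuple T} :=
  [set s : N.-tuple T | uniq s && (map g s == s)].

(** This is the case where [sigma] is the identity; fixed points lie in the stable image
    automatically, so no membership condition appears. *)
Lemma sum_fixed_tuples N (mu : {ffun T -> T} -> nat) :
    (forall (g : {ffun T -> T}) p, perm_on (stable_image g) p -> mu (post_perm p g) = mu g) ->
  \sum_(g : {ffun T -> T}) mu g * #|fixed_tuples N g| =
  \sum_(g : {ffun T -> T} | N <= #|stable_image g|) mu g.
Proof.
move=> muP; rewrite -(@sum_stable_tuples _ _ id _ mu) //.
apply: eq_bigr => g _; congr (_ * _); apply: eq_card => s; rewrite !inE.
congr (_ && _); apply/idP/andP => [/eqP gs|[]//]; split; last exact/eqP.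
apply/allP => x /(nthP x)[i si <-] /=; apply: stable_image_fix.
by rewrite -(nth_map _ x g si) gs.
Qed.

Lemma sum_cyclic_fixed_tuples N (mu : {ffun T -> T} -> nat) : 0 < N ->
    (forall (g : {ffun T -> T}) p, perm_on (stable_image g) p -> mu (post_perm p g) = mu g) ->
  N * \sum_(g : {ffun T -> T} | cyclic_stable_image N g) mu g +
    \sum_(g : {ffun T -> T}) mu g * #|fixed_tuples N.+1 g| =
  \sum_(g : {ffun T -> T}) mu g * #|fixed_tuples N g|.
Proof.
move=> N0 muP; rewrite !sum_fixed_tuples // sum_cyclic_stable_image //.
rewrite [RHS](bigID (fun g : {ffun T -> T} => #|stable_image g| == N)) /=.
congr (_ + _); apply: eq_bigl => g; first by case: eqP => [->|]; rewrite ?leqnn ?andbF.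
by rewrite ltn_neqAle eq_sym andbC.
Qed.

End CyclicCount.

(** * Counting tuples of functions through their composite *)

Section TupleCount.
Variable n : nat.
Local Notation endo := {ffun 'I_n -> 'I_n}.

Lemma card_ffun_map (N : nat) (u t : N.-tuple 'I_n) : uniq u ->
  #|[set h : endo | map h u == t]| = n ^ (n - N).
Proof.
move=> uu.
(* [F x] is the set of admissible values at [x]: the single entry [tnth t i] if [x] is the entry
   [tnth u i], and everything if [x] is not in [u]. *)
pose F x := [pred y : 'I_n | [forall i, (tnth u i == x) ==> (tnth t i == y)]].
have -> : #|[set h : endo | map h u == t]| = #|(family F : simpl_pred endo)|.
  apply: eq_card => h; rewrite inE; apply/eqP/familyP => [hu x|hF].
    apply/forallP => i; apply/implyP => /eqP <-.
    have <- : map_tuple h u = t by apply: val_inj.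
    by rewrite tnth_map.
  rewrite -[RHS]/(val t) -[LHS]/(val (map_tuple h u)); congr val.
  apply: eq_from_tnth => i; rewrite tnth_map.
  by have /forallP/(_ i) := hF (tnth u i); rewrite eqxx => /eqP.
rewrite card_family foldrE big_map big_enum /=.
rewrite (eq_bigr (fun x => if x \notin val u then n else 1)) => [|x _].
  rewrite -big_mkcond (eq_bigl (fun x => x \in [predC val u])) //.
  by rewrite prod_nat_const -[in n - N](card_ord n) -(cardC (mem (val u)))
    (card_uniqP uu) size_tuple addKn.
case: ifPn => [xu|/negPn/tnthP[i ->]]; last first.
  rewrite -(card1 (tnth t i)); apply: eq_card => y; rewrite !inE.
  apply/forallP/eqP => [/(_ i)|-> j]; first by rewrite eqxx => /eqP.
  by rewrite (inj_eq (elimT (tuple_uniqP u) uu)); apply/implyP => /eqP ->.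
rewrite -[RHS]card_ord; apply: eq_card => y; rewrite !inE.
by apply/forallP => i; case: eqP => // ix; rewrite -ix mem_tnth in xu.
Qed.

Definition composite_ffun k (f : fun_tuple k n) : endo := [ffun x => composite f x].

Lemma big_composite_recr k (Phi : endo -> nat) :
  \sum_(f : fun_tuple k.+1 n) Phi (composite_ffun f) =
  \sum_(f : fun_tuple k n) \sum_(h : endo) Phi [ffun x => h (composite f x)].
Proof.
(* The index [ord_max] carries the function applied last. *)
pose join (u : fun_tuple k n * endo) : fun_tuple k.+1 n :=
  [ffun i => if unlift ord_max i is Some j then u.1 j else u.2].
pose split (f : fun_tuple k.+1 n) : fun_tuple k n * endo :=
  ([ffun j => f (lift ord_max j)], f ord_max).
have joinK : cancel join split.
  move=> [f h]; congr (_, _); last by rewrite ffunE unlift_none.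
  by apply/ffunP => j; rewrite !ffunE liftK.
have splitK : cancel split join.
  move=> f; apply/ffunP => i; rewrite ffunE.
  by case: unliftP => [j|] -> /=; rewrite ?ffunE.
rewrite pair_big /= (reindex join); last by exists split => ? _.
apply: eq_bigr => -[f h] _; congr Phi; apply/ffunP => x; rewrite !ffunE.
rewrite /composite enum_ordSr foldl_rcons ffunE unlift_none /=; congr (h _).
elim: (enum 'I_k) x => //= i s IHs x; rewrite IHs ffunE.
have -> : widen_ord (leqnSn k) i = lift ord_max i.
  by apply: val_inj; rewrite /= /bump leqNgt ltn_ord.
by rewrite liftK.
Qed.

(** Up to normalisation this is the law of the composite; it serves as the weight [mu]. *)
Definition composite_weight k (g : endo) := #|[set f : fun_tuple k n | composite_ffun f == g]|.

Lemma sum_composite_weight k (Phi : endo -> nat) :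
  \sum_g composite_weight k g * Phi g = \sum_(f : fun_tuple k n) Phi (composite_ffun f).
Proof.
rewrite [RHS](partition_big (@composite_ffun k) predT) //=; apply: eq_bigr => g _.
rewrite (eq_bigr (fun=> Phi g)) => [|f /eqP -> //].
by rewrite sum_nat_const /composite_weight cardsE.
Qed.

(** The last function absorbs [p]. This takes at least one function, as the composite of the empty
    tuple is always the identity. *)
Lemma composite_weight_post_perm k (p : {perm 'I_n}) g :
  composite_weight k.+1 (post_perm p g) = composite_weight k.+1 g.
Proof.
have weightE g' : composite_weight k.+1 g' = \sum_(f : fun_tuple k n)
    \sum_(h : endo) ([ffun x => h (composite f x)] == g').
  rewrite -(big_composite_recr k (fun g => g == g')).
  by rewrite /composite_weight -sum1dep_card big_mkcond.
rewrite !weightE; apply: eq_bigr => f _.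
rewrite (reindex_inj (can_inj (post_permK p))); apply: eq_bigr => h _.
rewrite -(inj_eq (can_inj (post_permK p)) _ g); congr (nat_of_bool (_ == _)).
by apply/ffunP => x; rewrite !ffunE.
Qed.

Lemma card_uniq_tuple N : #|[set t : N.-tuple 'I_n | uniq t]| = n ^_ N.
Proof.
rewrite -[in RHS](card_ord n) -[RHS](card_uniq_tuples N predT).
by apply: eq_card => t; rewrite !inE all_predT.
Qed.

Lemma card_ffun_uniq_map N (u : N.-tuple 'I_n) : uniq u ->
  #|[set h : endo | uniq (map h u)]| = n ^_ N * n ^ (n - N).
Proof.
move=> uu; rewrite -card_uniq_tuple.
rewrite -sum1dep_card (partition_big (fun h : endo => map_tuple h u) (fun t => uniq t)) //=.
rewrite -sum_nat_const; apply: eq_big => [t|t ut]; first by rewrite inE.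
rewrite -(card_ffun_map t uu) -sum1dep_card; apply: eq_bigl => h.
rewrite -val_eqE /=; apply: andb_idl => /eqP ->; exact: ut.
Qed.

(** A repetition created at some stage persists, so every function in turn must keep the current
    tuple injective. *)
Lemma card_composite_uniq_map k N (u : N.-tuple 'I_n) : uniq u ->
  \sum_(f : fun_tuple k n) uniq (map (composite f) u) = (n ^_ N * n ^ (n - N)) ^ k.
Proof.
move=> uu; elim: k => [|k IHk].
  rewrite (eq_bigr (fun=> 1)) => [|f _].
    by rewrite sum1_card card_ffun card_ord.
  rewrite -[in uniq _](map_id u) in uu *; rewrite (eq_map (_ : _ =1 id)) ?uu // => x.
  by rewrite /composite (size0nil (size_enum_ord 0)).
transitivity (\sum_(f : fun_tuple k.+1 n) uniq (map (composite_ffun f) u) : nat).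
  by apply: eq_bigr => f _; congr (nat_of_bool (uniq _)); apply: eq_map => x; rewrite ffunE.
rewrite (big_composite_recr k (fun g => uniq (map g u))) expnSr -IHk big_distrl.
apply: eq_bigr => f _ /=.
transitivity (\sum_(h : endo) uniq (map h (map (composite f) u)) : nat).
  apply: eq_bigr => h _; congr (nat_of_bool (uniq _)); rewrite -map_comp.
  by apply: eq_map => x; rewrite ffunE.
have [fu|/negPf fu] := boolP (uniq (map (composite f) u)).
  rewrite mul1n -(@card_ffun_uniq_map _ (map_tuple (composite f) u)) //.
  by rewrite -sum1dep_card [RHS]big_mkcond.
rewrite mul0n big1 // => h _.
by have := contraFF (@map_uniq _ _ h _) fu; move=> ->.
Qed.

(** The first [k] functions carry [s] through injective tuples; the last one must return it to [s],
    with only [n ^ (n - N)] choices. Summing over the [n ^_ N] tuples [s] restores the missing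
    factor. *)
Lemma sum_composite_fixed_tuples k N :
  \sum_(f : fun_tuple k.+1 n) #|fixed_tuples N (composite_ffun f)| =
  (n ^_ N * n ^ (n - N)) ^ k.+1.
Proof.
rewrite (big_composite_recr k (fun g => #|fixed_tuples N g|)).
transitivity (\sum_(s : N.-tuple 'I_n | uniq s) n ^ (n - N) *
    \sum_(f : fun_tuple k n) uniq (map (composite f) s)).
  transitivity (\sum_(f : fun_tuple k n) \sum_(s : N.-tuple 'I_n | uniq s)
      \sum_(h : endo) (map h (map (composite f) s) == s : nat)).
    apply: eq_bigr => f _; rewrite exchange_big; apply: eq_bigr => h _ /=.
    rewrite -big_mkcondr -sum1dep_card; apply: eq_bigl => s; congr (_ && (_ == _)).
    by rewrite -map_comp; apply: eq_map => x; rewrite ffunE.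
  rewrite exchange_big; apply: eq_bigr => s us; rewrite big_distrr.
  apply: eq_bigr => f _ /=.
  have [fs|/negPf fs] := boolP (uniq (map (composite f) s)).
    rewrite muln1 -(@card_ffun_map _ (map_tuple (composite f) s) s) //.
    by rewrite -sum1dep_card [RHS]big_mkcond.
  rewrite muln0 big1 // => h _; case: eqP => // hs.
  by rewrite (map_uniq (_ : uniq (map h _))) ?hs in fs.
rewrite (eq_bigr (fun=> n ^ (n - N) * (n ^_ N * n ^ (n - N)) ^ k)); last first.
  by move=> s us; rewrite card_composite_uniq_map.
rewrite sum_nat_const expnS mulnA; congr (_ * _ * _).
by rewrite -card_uniq_tuple cardsE.
Qed.

Lemma card_cyclic_composite k N : 0 < N ->
  N * #|[set f : fun_tuple k.+1 n | cyclic_stable_image N (composite_ffun f)]| +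
    (n ^_ N.+1 * n ^ (n - N.+1)) ^ k.+1 =
  (n ^_ N * n ^ (n - N)) ^ k.+1.
Proof.
move=> N0; rewrite -!sum_composite_fixed_tuples.
rewrite -(sum_composite_weight k.+1 (fun g => #|fixed_tuples N.+1 g|)).
rewrite -(sum_composite_weight k.+1 (fun g => #|fixed_tuples N g|)).
rewrite -(@sum_cyclic_fixed_tuples _ N (composite_weight k.+1)) //; last first.
  by move=> g p _; apply: composite_weight_post_perm.
congr (_ * _ + _); transitivity (\sum_(f : fun_tuple k.+1 n)
    cyclic_stable_image N (composite_ffun f) : nat).
  by rewrite -sum1dep_card big_mkcond.
rewrite -(sum_composite_weight k.+1 (fun g => cyclic_stable_image N g)) [RHS]big_mkcond.
by apply: eq_bigr => g _; case: ifP; rewrite ?muln0 ?muln1.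
Qed.

End TupleCount.

(** * Agreement with the stated notion of eventual cyclicity *)

Lemma eventually_cyclicP k n N (f : fun_tuple k n) :
  eventually_cyclic N f <-> cyclic_stable_image N (composite_ffun f).
Proof.
have -> : (composite_ffun f : 'I_n -> 'I_n) = composite f.
  by apply/funext => x; rewrite ffunE.
split=> [[Y [[M YM] YN [s [/andP[cs us] Ys]]]]|/andP[/eqP EN /set0Pn[s sE]]].
  (* At the exponent [maxn M n] the iterated image is both [Y] and the stable image. *)
  have EY : stable_image (composite f) = Y.
    by rewrite -(YM (maxn M n)) ?leq_maxl // stable_image_imset_iter // card_ord leq_maxr.
  rewrite /cyclic_stable_image EY YN eqxx; apply/set0Pn.
  have sN : size s == N by rewrite -YN Ys cardsE (card_uniqP us).
  exists (Tuple sN); rewrite inE /= -fcycle_map_rot us cs EY andbT /=.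
  by apply/allP => x xs; rewrite /= Ys inE.
exists (stable_image (composite f)); split => //.
  by exists n => m nm; rewrite stable_image_imset_iter // card_ord.
exists s; split; last by apply/setP => x; rewrite inE (mem_cycle_tuple EN sE).
by move: sE; rewrite inE -fcycle_map_rot => /and3P[us _ cs]; apply/andP.
Qed.

(** * Closed form of the probability and its limit *)

Section Limit.
Import Order.TTheory GRing.Theory Num.Theory.
Import numFieldNormedType.Exports.
Local Open Scope classical_set_scope.
Local Open Scope ring_scope.
Variable R : realType.

Lemma ffact_ratio N n : (0 < n)%N -> (N <= n)%N ->
  (n ^_ N * n ^ (n - N))%:R / (n ^ n)%:R = \prod_(i < N) (1 - i%:R / n%:R) :> R.
Proof.
move=> n0 Nn; have n0R : n%:R != 0 :> R by rewrite pnatr_eq0 -lt0n.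
have ffactE : (n ^_ N)%:R = n%:R ^+ N * \prod_(i < N) (1 - i%:R / n%:R) :> R.
  elim: N Nn => [|N IHN] Nn; first by rewrite ffactn0 big_ord0 mulr1.
  rewrite ffactnSr natrM IHN 1?ltnW // big_ord_recr exprSr natrB 1?ltnW //=.
  rewrite -!mulrA; congr (_ * _); rewrite mulrCA; congr (_ * _).
  by rewrite mulrBr mulr1 mulrCA divff ?mulr1.
have -> : (n ^ n = n ^ N * n ^ (n - N))%N by rewrite -expnD subnKC.
by rewrite !natrM ffactE !natrX -mulf_div divff ?expf_neq0 // mulr1 mulrAC divff
  ?expf_neq0 // mul1r.
Qed.

Lemma proba_eventually_cyclicE k N n : (0 < k)%N -> (0 < N)%N -> (N < n)%N ->
  proba_eventually_cyclic R k N n =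
  N%:R^-1 * ((\prod_(i < N) (1 - i%:R / n%:R)) ^+ k -
             (\prod_(i < N.+1) (1 - i%:R / n%:R)) ^+ k).
Proof.
case: k => // k _ N0 Nn; have n0 : (0 < n)%N by apply: leq_ltn_trans Nn.
have N0R : N%:R != 0 :> R by rewrite pnatr_eq0 -lt0n.
rewrite /proba_eventually_cyclic.
have -> : [set f : fun_tuple k.+1 n | `[< eventually_cyclic N f >]]%SET =
    [set f : fun_tuple k.+1 n | cyclic_stable_image N (composite_ffun f)]%SET.
  by apply/setP => f; rewrite !inE; apply/asboolP/idP => /eventually_cyclicP.
rewrite !card_ffun !card_ord -!ffact_ratio // 1?ltnW // !expr_div_n -mulrBl.
rewrite mulrA -!natrX; congr (_ / _).
by rewrite -(card_cyclic_composite _ _ N0) natrD addrK natrM mulKf.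
Qed.

(** With [x = i / n], the bounds [expR (- x / (1 - x)) <= 1 - x <= expR (- x)] are raised to the
    power [c * n], where [c * n * x = c * i]. *)
Lemma cvg_expr_expR (c i : nat) :
  (1 - i%:R / n%:R) ^+ (c * n) @[n --> \oo] --> (expR (- (c * i)%:R) : R).
Proof.
have cvg0 : (i%:R / n%:R : R) @[n --> \oo] --> (0 : R).
  rewrite -[0](mulr0 i%:R); apply: cvgM; first exact: cvg_cst.
  apply/(@gtr0_cvgV0 _ _ _ _ (fun n => n%:R)); last exact: cvgr_idn.
  by near=> n; rewrite ltr0n; near: n; exact: nbhs_infty_gt.
have cvg1 : (1 - i%:R / n%:R : R) @[n --> \oo] --> (1 : R).
  by rewrite -[X in _ --> X]subr0; apply: cvgB => //; exact: cvg_cst.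
apply: (@squeeze_cvgr _ _ _ _ (fun n => expR (- (c * i)%:R * (1 - i%:R / n%:R)^-1))
  (fun=> expR (- (c * i)%:R))).
- near=> n.
  have n0 : (0 < n)%N by near: n; exact: nbhs_infty_gt.
  have lt_in : (i < n)%N by near: n; exact: nbhs_infty_gt.
  have n0R : n%:R != 0 :> R by rewrite pnatr_eq0 -lt0n.
  set x := i%:R / n%:R; have x1 : 0 < 1 - x.
    by rewrite subr_gt0 ltr_pdivrMr ?ltr0n // mul1r ltr_nat.
  have ciE : (c * i)%:R = (c * n)%:R * x :> R.
    by rewrite !natrM /x -mulrA [n%:R * _]mulrCA divff // mulr1.
  rewrite ciE; apply/andP; split.
  + rewrite mulNr -mulrA -mulrN expRM_natl lerXn2r ?nnegrE ?expR_ge0 ?(ltW x1) //.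
    rewrite expRN -[leRHS]invrK lef_pV2 ?posrE ?expR_gt0 ?invr_gt0 //.
    (* With [y = x / (1 - x)], one has [1 + y = (1 - x)^-1], so the lower bound is the inverse of
       [1 + y <= expR y]. *)
    apply: le_trans (expR_ge1Dx _).
    by rewrite -[X in X + _ / _](divff (lt0r_neq0 x1)) -mulrDl subrK mul1r.
  + rewrite -[X in expR X]mulrN expRM_natl lerXn2r ?nnegrE ?expR_ge0 ?(ltW x1) //.
    exact: expR_ge1Dx.
- apply: (@continuous_cvg _ _ _ _ _ _ (@expR R)); first exact: continuous_expR.
  rewrite -[X in _ --> X]mulr1; apply: cvgM; first exact: cvg_cst.
  rewrite -[X in _ --> X]invr1.
  by apply: cvgV => //; rewrite oner_eq0.
- exact: cvg_cst.
Unshelve. all: by end_near. Qed.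

Lemma cvg_prod_expR (c N : nat) :
  (\prod_(i < N) (1 - i%:R / n%:R)) ^+ (c * n) @[n --> \oo] -->
    (expR (- (c * 'C(N, 2))%:R) : R).
Proof.
elim: N => [|N IHN].
  under eq_cvg do rewrite big_ord0 expr1n.
  by rewrite muln0 oppr0 expR0; exact: cvg_cst.
under eq_cvg do rewrite big_ord_recr exprMn.
by rewrite binS bin1 mulnDr natrD opprD expRD; apply: cvgM => //; exact: cvg_expr_expR.
Qed.

End Limit.

Import Order.TTheory GRing.Theory Num.Theory.
Import numFieldNormedType.Exports.

Local Open Scope classical_set_scope.
Local Open Scope ring_scope.

Theorem corollary4p9 (R : realType) (c N : nat) (hc : (0 < c)%N) (hN : (0 < N)%N) :
  proba_eventually_cyclic R (c * n) N n @[n --> \oo] -->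
    N%:R^-1 * expR (- (c%:R * 'C(N, 2)%:R)) * (1 - expR (- (c%:R * N%:R))).
Proof.
(* The limit becomes a difference of two exponentials with binomials ['C(N, 2)] and ['C(N.+1, 2)],
   one for each product in the closed form. *)
rewrite -mulrA mulrBr mulr1 -expRD -opprD -mulrDr -natrD.
have -> : ('C(N, 2) + N = 'C(N.+1, 2))%N by rewrite binS bin1.
rewrite -!natrM.
apply: (@cvg_trans _ ((N%:R^-1 * ((\prod_(i < N) (1 - i%:R / n%:R)) ^+ (c * n) -
    (\prod_(i < N.+1) (1 - i%:R / n%:R)) ^+ (c * n)) : R) @[n --> \oo])).
  (* The closed form is available only once [N < n], hence eventually. *)
  apply: near_eq_cvg; near=> n.
  have Nn : (N < n)%N by near: n; exact: nbhs_infty_gt.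
  by rewrite proba_eventually_cyclicE // muln_gt0 hc (leq_ltn_trans _ Nn).
by apply: cvgM; [exact: cvg_cst|apply: cvgB]; exact: cvg_prod_expR.
Unshelve. all: by end_near. Qed.
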